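(* The update operator $\oplus_3$ satisfies, for all extended logic programs $P,P_1,P_2$ and every rule $x$: (BK-1) $P\oplus_3\{x\}$ is a program; (BK-2) $P_1\oplus_3P_2\vdash_{N_2}P_2$; (BK-3) $P_1\cup P_2\vdash_{N_2}P_1\oplus_3P_2$; (BK-5) if $P_2\equiv_{N_2}\bot$ then $P_1\oplus_3P_2\equiv_{N_2}\bot$. Moreover it satisfies (BK-6) when $P_1$ and $P_2$ are tau-free: for any extended logic program $P$ and tau-free extended logic programs $P_1,P_2$, if $P_1\equiv_{N_2}P_2$ then $P\oplus_3P_1$ and $P\oplus_3P_2$ have the same answer sets.
   Context: Formulas use $\wedge,\vee,\rightarrow,\bot$ and strong negation $\sim$; $\lnot F$ is $F\rightarrow\bot$, $\top$ is $\bot\rightarrow\bot$. A literal is an atom $a$ or $\sim a$; $\sim L$ is the complement of $L$. An extended logic program (ELP) is a finite set of rules $r$: $L\leftarrow B_1,\dots,B_m,\lnot B_{m+1},\dots,\lnot B_n$ ($L,B_i$ literals, $\top$ or $\bot$); $H(r)=L$, $B(r)$ the body ($\top$ if empty); constraint if $H(r)=\bot$. A program is a finite set of formulas $G\rightarrow l$, $l$ a literal, $G$ built from literals, $\top,\bot$ by $\wedge,\vee,\lnot$. An ELP is tau-free if it contains no rule of the form $l\leftarrow l,\alpha$ (with $l$ a literal and $\alpha$ a possibly empty body). $\mathrm{N}_2$ is intuitionistic logic plus Nelson's axioms ($\sim(\alpha\rightarrow\beta)\leftrightarrow\alpha\wedge\sim\beta$, $\sim(\alpha\wedge\beta)\leftrightarrow\sim\alpha\vee\sim\beta$,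 $\sim(\alpha\vee\beta)\leftrightarrow\sim\alpha\wedge\sim\beta$, $\alpha\leftrightarrow\sim\sim\alpha$, $\sim\lnot\alpha\leftrightarrow\alpha$, $\sim a\rightarrow\lnot a$) and $\alpha\vee(\alpha\rightarrow\beta)\vee\lnot\beta$. $T\vdash_{N_2}T'$: $T$ derives every formula of $T'$; $\equiv_{N_2}$: mutual derivability; $\equiv_{N_2}\bot$: $\mathrm{N}_2$-inconsistent. For a finite set of formulas $T$ over atoms $\mathcal{A}$, a consistent $M\subseteq Lit_{\mathcal{A}}$ is an answer set iff $T\cup\{\lnot l: l\in Lit_{\mathcal{A}}\setminus M\}\cup\{\lnot\lnot l:l\in M\}$ is $\mathrm{N}_2$-consistent and $\mathrm{N}_2$-derives each element of $M$. Operator $\oplus_3$: for a program $P$ and literal $L$ let $K_L=\{B(r): r\in P, H(r)=L\}$ and $sup(L,P)=\bot$ if no rule of $P$ has head $L$, $\top$ if some rule of $P$ with head $L$ has body $\top$, and $\bigvee K_L$ otherwise. $P_1\oplus_3P_2$ consists of (i) all constraints of $P_1\cup P_2$; (ii) for each non-constraint $r\in P_1$ with $H(r)=L$: $L\leftarrow B(r),\lnot sup(\sim L,P_2)$; (iii) all rules of $P_2$.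
   Formalization: In (BK-1), formulas of a program may have head ⊤ or ⊥ as well as a literal, as rules of extended logic programs may; with literal heads only, (BK-1) fails for P = {⊥ ← a}, whose constraint is kept in the update. *)

(* Defs.v *)
From HB Require Import structures.
From mathcomp Require Import all_boot finmap.
From mathcomp Require Import classical_sets.

Set Implicit Arguments.
Unset Strict Implicit.
Unset Printing Implicit Defensive.

Local Open Scope fset_scope.

(* The type [A] of atoms plays the role of the signature: a set of formulas
   over [A] is a set of elements of [formula A], and Lit_A is [literal A]. *)

Inductive formula (A : Type) : Type :=
| Atom of A
| Bot
| And of formula A & formula A
| Or of formula A & formula A
| Imp of formula A & formula A
| SNeg of formula A.

Arguments Bot {A}.

Definition Not {A : Type} (F : formula A) : formula A := Imp F Bot.
Definition Top {A : Type} : formula A := Imp Bot Bot.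
Definition Iff {A : Type} (F G : formula A) : formula A :=
  And (Imp F G) (Imp G F).

Section FormulaChoice.
Variable A : choiceType.

Fixpoint formula_encode (F : formula A) : GenTree.tree A :=
  match F with
  | Atom a => GenTree.Leaf a
  | Bot => GenTree.Node 0 [::]
  | And F G => GenTree.Node 1 [:: formula_encode F; formula_encode G]
  | Or F G => GenTree.Node 2 [:: formula_encode F; formula_encode G]
  | Imp F G => GenTree.Node 3 [:: formula_encode F; formula_encode G]
  | SNeg F => GenTree.Node 4 [:: formula_encode F]
  end.

Fixpoint formula_decode (t : GenTree.tree A) : formula A :=
  match t with
  | GenTree.Leaf a => Atom a
  | GenTree.Node 1 [:: t; u] => And (formula_decode t) (formula_decode u)
  | GenTree.Node 2 [:: t; u] => Or (formula_decode t) (formula_decode u)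
  | GenTree.Node 3 [:: t; u] => Imp (formula_decode t) (formula_decode u)
  | GenTree.Node 4 [:: t] => SNeg (formula_decode t)
  | _ => Bot
  end.

Lemma formula_encodeK : cancel formula_encode formula_decode.
Proof. by elim=> //= [F -> G ->|F -> G ->|F -> G ->|F ->]. Qed.

HB.instance Definition _ :=
  Choice.copy (formula A) (can_type formula_encodeK).

End FormulaChoice.

Inductive N2_axiom (A : Type) : formula A -> Prop :=
| ax_K F G : N2_axiom (Imp F (Imp G F))
| ax_S F G H :
    N2_axiom (Imp (Imp F (Imp G H)) (Imp (Imp F G) (Imp F H)))
| ax_andl F G : N2_axiom (Imp (And F G) F)
| ax_andr F G : N2_axiom (Imp (And F G) G)
| ax_and F G : N2_axiom (Imp F (Imp G (And F G)))
| ax_orl F G : N2_axiom (Imp F (Or F G))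
| ax_orr F G : N2_axiom (Imp G (Or F G))
| ax_or F G H : N2_axiom (Imp (Imp F H) (Imp (Imp G H) (Imp (Or F G) H)))
| ax_bot F : N2_axiom (Imp Bot F)
| ax_snegI F G : N2_axiom (Iff (SNeg (Imp F G)) (And F (SNeg G)))
| ax_snegA F G : N2_axiom (Iff (SNeg (And F G)) (Or (SNeg F) (SNeg G)))
| ax_snegO F G : N2_axiom (Iff (SNeg (Or F G)) (And (SNeg F) (SNeg G)))
| ax_snegK F : N2_axiom (Iff F (SNeg (SNeg F)))
| ax_snegN F : N2_axiom (Iff (SNeg (Not F)) F)
| ax_sneg_atom a : N2_axiom (Imp (SNeg (Atom a)) (Not (Atom a)))
| ax_HT F G : N2_axiom (Or F (Or (Imp F G) (Not G))).

Inductive N2_derives (A : Type) (T : set (formula A)) : formula A -> Prop :=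
| der_hyp F : T F -> N2_derives T F
| der_axiom F : N2_axiom F -> N2_derives T F
| der_mp F G : N2_derives T (Imp F G) -> N2_derives T F -> N2_derives T G.

Definition N2_derives_all {A : Type} (T T' : set (formula A)) : Prop :=
  forall F, T' F -> N2_derives T F.

Definition N2_equiv {A : Type} (T T' : set (formula A)) : Prop :=
  N2_derives_all T T' /\ N2_derives_all T' T.

Definition N2_inconsistent {A : Type} (T : set (formula A)) : Prop :=
  N2_derives T Bot.

Definition theory {A : choiceType} (T : {fset formula A}) : set (formula A) :=
  fun F => F \in T.

Inductive literal (A : Type) : Type := Pos of A | Neg of A.

Definition complement {A : Type} (l : literal A) : literal A :=
  match l with Pos a => Neg a | Neg a => Pos a end.

Definition lit_formula {A : Type} (l : literal A) : formula A :=
  match l with Pos a => Atom a | Neg a => SNeg (Atom a) end.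

(* What may occur in a rule: a literal, or one of the two constants. *)
Inductive xliteral (A : Type) : Type := XLit of literal A | XTop | XBot.

Arguments XTop {A}.
Arguments XBot {A}.

Definition xlit_formula {A : Type} (L : xliteral A) : formula A :=
  match L with XLit l => lit_formula l | XTop => Top | XBot => Bot end.

(* [Rule L [:: B_1; ..; B_m] [:: B_m+1; ..; B_n]] stands for the rule
   L <- B_1, .., B_m, not B_m+1, .., not B_n *)
Record rule (A : Type) : Type := Rule {
  rule_head : xliteral A;
  pos_body : seq (xliteral A);
  neg_body : seq (xliteral A) }.

Section RuleChoice.
Variable A : choiceType.

Definition literal_encode (l : literal A) : A + A :=
  match l with Pos a => inl a | Neg a => inr a end.
Definition literal_decode (s : A + A) : literal A :=
  match s with inl a => Pos a | inr a => Neg a end.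
Lemma literal_encodeK : cancel literal_encode literal_decode.
Proof. by case. Qed.
HB.instance Definition _ :=
  Choice.copy (literal A) (can_type literal_encodeK).

Definition xliteral_encode (L : xliteral A) : literal A + bool :=
  match L with XLit l => inl l | XTop => inr true | XBot => inr false end.
Definition xliteral_decode (s : literal A + bool) : xliteral A :=
  match s with inl l => XLit l | inr true => XTop | inr false => XBot end.
Lemma xliteral_encodeK : cancel xliteral_encode xliteral_decode.
Proof. by case. Qed.
HB.instance Definition _ :=
  Choice.copy (xliteral A) (can_type xliteral_encodeK).

Definition rule_encode (r : rule A) :
    xliteral A * seq (xliteral A) * seq (xliteral A) :=
  (rule_head r, pos_body r, neg_body r).
Definition rule_decode
    (t : xliteral A * seq (xliteral A) * seq (xliteral A)) : rule A :=
  Rule t.1.1 t.1.2 t.2.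
Lemma rule_encodeK : cancel rule_encode rule_decode.
Proof. by case. Qed.
HB.instance Definition _ := Choice.copy (rule A) (can_type rule_encodeK).

End RuleChoice.

Notation elp A := {fset rule A}.

Fixpoint conj_seq {A : Type} (s : seq (formula A)) : formula A :=
  match s with
  | [::] => Top
  | [:: F] => F
  | F :: s' => And F (conj_seq s')
  end.

Fixpoint disj_seq {A : Type} (s : seq (formula A)) : formula A :=
  match s with
  | [::] => Bot
  | [:: F] => F
  | F :: s' => Or F (disj_seq s')
  end.

Definition body {A : Type} (r : rule A) : formula A :=
  conj_seq ([seq xlit_formula B | B <- pos_body r] ++
        [seq Not (xlit_formula B) | B <- neg_body r]).

Definition rule_formula {A : Type} (r : rule A) : formula A :=
  Imp (body r) (xlit_formula (rule_head r)).

Definition is_constraint {A : choiceType} (r : rule A) : bool :=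
  rule_head r == XBot.

Definition elp_formulas {A : choiceType} (P : elp A) : {fset formula A} :=
  [fset rule_formula r | r in P].

(* A body is a conjunction, so [l <- l, alpha] does not fix the place of [l]
   among the positive body elements. *)
Definition tau_free {A : choiceType} (P : elp A) : Prop :=
  forall (r : rule A) (l : literal A),
    r \in P -> rule_head r = XLit l -> XLit l \notin pos_body r.

Inductive program_body (A : Type) : formula A -> Prop :=
| pb_lit l : program_body (lit_formula l)
| pb_top : program_body Top
| pb_bot : program_body Bot
| pb_and F G : program_body F -> program_body G -> program_body (And F G)
| pb_or F G : program_body F -> program_body G -> program_body (Or F G)
| pb_not F : program_body F -> program_body (Not F).

(* Heads range over the same extended literals as in rules: constraints are
   program formulas. *)
Definition is_program {A : choiceType} (T : {fset formula A}) : Prop :=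
  forall F, F \in T ->
    exists (G : formula A) (L : xliteral A),
      program_body G /\ F = Imp G (xlit_formula L).

Definition bodies {A : choiceType} (L : literal A) (P : elp A) :
    {fset formula A} :=
  [fset body r | r in P & rule_head r == XLit L].

Definition sup {A : choiceType} (L : literal A) (P : elp A) : formula A :=
  if bodies L P == fset0 then Bot
  else if Top \in bodies L P then Top
  else disj_seq (enum_fset (bodies L P)).

(* sup of the complement of a rule head; the complement of [XTop] is not the
   head of any rule, whence [Bot], and [XBot] does not arise in [update3]. *)
Definition sup_complement {A : choiceType} (L : xliteral A) (P : elp A) :
    formula A :=
  if L is XLit l then sup (complement l) P else Bot.

Definition weakened_rule {A : choiceType} (P2 : elp A) (r : rule A) :
    formula A :=
  Imp (And (body r) (Not (sup_complement (rule_head r) P2)))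
      (xlit_formula (rule_head r)).

Definition update3 {A : choiceType} (P1 P2 : elp A) : {fset formula A} :=
  [fset rule_formula r | r in P1 `|` P2 & is_constraint r]
  `|` [fset weakened_rule P2 r | r in P1 & ~~ is_constraint r]
  `|` elp_formulas P2.

Definition consistent_literals {A : Type} (M : set (literal A)) : Prop :=
  forall l, M l -> ~ M (complement l).

Definition completion {A : choiceType} (T : {fset formula A})
    (M : set (literal A)) : set (formula A) :=
  (theory T
   `|` [set Not (lit_formula l) | l in ~` M]
   `|` [set Not (Not (lit_formula l)) | l in M])%classic.

Definition answer_set {A : choiceType} (T : {fset formula A})
    (M : set (literal A)) : Prop :=
  [/\ consistent_literals M,
      ~ N2_inconsistent (completion T M) &
      forall l, M l -> N2_derives (completion T M) (lit_formula l)].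

(* Main.v *)
(** Over the completion of a program by a set of literals [M], every negated
    program body is decided by evaluating it in [M].  Hence, for (BK-6), it is
    enough that [sup L P1] and [sup L P2] take the same value in any common
    consistent model [M] of the equivalent programs [P1] and [P2].  If a rule of
    [P1] with head [L] has its body true in [M], then, [L] not being in its
    positive body, the rule fails in the here-and-there interpretation
    [(M \ {L}, M)].  By soundness of N2 some rule of [P2] fails there too, and
    such a rule must have head [L] and a body true in [M]. *)

Require Import Defs.
From mathcomp Require Import all_boot finmap.
From mathcomp Require Import classical_sets boolp.

Local Open Scope fset_scope.

(** * Derivations in N2: the deduction theorem and intuitionistic laws of negation *)

Section Derivations.
Set Implicit Arguments.
Unset Strict Implicit.
Context {A : Type}.
Implicit Types (T U : set (formula A)) (F G H : formula A).

Lemma N2_cut T U F : N2_derives_all T U -> N2_derives U F -> N2_derives T F.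
Proof.
move=> TU; elim=> {F} [F /TU //|F /der_axiom //|F G _ FG _ F'].
exact: der_mp FG F'.
Qed.

Lemma N2_mono T U F : subset T U -> N2_derives T F -> N2_derives U F.
Proof. by move=> TU; apply: N2_cut => G /TU; apply: der_hyp. Qed.

Lemma N2_imp_const T F G : N2_derives T G -> N2_derives T (Imp F G).
Proof. by apply: der_mp; apply: der_axiom; apply: ax_K. Qed.

(** Modus ponens is the only inference rule, so [ax_K] and [ax_S] carry the induction on
    derivations. *)
Lemma N2_deduction T F G :
  N2_derives (F |` T)%classic G -> N2_derives T (Imp F G).
Proof.
elim=> {G} [G [->|TG]|G ax|G H _ FGH _ FG].
(* This is the combinator term S K K, which proves [Imp F F]. *)
- apply: (@der_mp _ _ (Imp F (Imp F F))); last exact/der_axiom/ax_K.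
  apply: (@der_mp _ _ (Imp F (Imp (Imp F F) F))); last exact/der_axiom/ax_K.
  exact/der_axiom/ax_S.
- exact/N2_imp_const/der_hyp.
- exact/N2_imp_const/der_axiom.
- by apply: der_mp FG; apply: der_mp FGH; apply: der_axiom; apply: ax_S.
Qed.

Lemma N2_weaken T F G : N2_derives T G -> N2_derives (F |` T)%classic G.
Proof. by apply: N2_mono => H; right. Qed.

Lemma N2_assumption T F : N2_derives (F |` T)%classic F.
Proof. by apply: der_hyp; left. Qed.

Lemma N2_imp_trans T F G H :
  N2_derives T (Imp F G) -> N2_derives T (Imp G H) -> N2_derives T (Imp F H).
Proof.
move=> FG GH; apply: N2_deduction; apply: der_mp (N2_weaken F GH) _.
exact: der_mp (N2_weaken F FG) (N2_assumption T F).
Qed.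

Lemma N2_contra T F G :
  N2_derives T (Imp F G) -> N2_derives T (Imp (Not G) (Not F)).
Proof.
move=> FG; apply: N2_deduction.
exact: N2_imp_trans (N2_weaken _ FG) (N2_assumption _ _).
Qed.

Lemma N2_notnotI T F : N2_derives T F -> N2_derives T (Not (Not F)).
Proof.
move=> TF; apply: N2_deduction.
exact: der_mp (N2_assumption _ _) (N2_weaken _ TF).
Qed.

Lemma N2_andl T F G : N2_derives T (Imp (And F G) F).
Proof. exact/der_axiom/ax_andl. Qed.

Lemma N2_andr T F G : N2_derives T (Imp (And F G) G).
Proof. exact/der_axiom/ax_andr. Qed.

Lemma N2_andI T F G :
  N2_derives T F -> N2_derives T G -> N2_derives T (And F G).
Proof.
by move=> TF; apply: der_mp; apply: der_mp TF; apply: der_axiom; apply: ax_and.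
Qed.

Lemma N2_and_mono T F G H :
  N2_derives T (Imp G H) -> N2_derives T (Imp (And F G) (And F H)).
Proof.
move=> GH; apply: N2_deduction; apply: N2_andI.
  exact: der_mp (N2_andl _ _ _) (N2_assumption _ _).
apply: der_mp (N2_weaken _ GH) _.
exact: der_mp (N2_andr _ _ _) (N2_assumption _ _).
Qed.

Lemma N2_notnot_and T F G :
  N2_derives T (Not (Not F)) -> N2_derives T (Not (Not G)) ->
  N2_derives T (Not (Not (And F G))).
Proof.
move=> nnF nnG; apply: N2_deduction; apply: der_mp (N2_weaken _ nnF) _.
apply: N2_deduction; apply: der_mp (N2_weaken _ (N2_weaken _ nnG)) _.
apply: N2_deduction.
apply: (@der_mp _ _ (And F G)); first by do 2 apply: N2_weaken; apply: N2_assumption.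
by apply: N2_andI; [apply: N2_weaken|]; apply: N2_assumption.
Qed.

Lemma N2_not_or T F G :
  N2_derives T (Not F) -> N2_derives T (Not G) -> N2_derives T (Not (Or F G)).
Proof.
by move=> nF; apply: der_mp; apply: der_mp nF; apply: der_axiom; apply: ax_or.
Qed.

End Derivations.

(** * Here-and-there models: soundness of N2, and program bodies decided by a set of literals *)

Section Semantics.
Set Implicit Arguments.
Unset Strict Implicit.
Context {A : Type}.
Implicit Types (V : bool -> set (literal A)) (M : set (literal A)).

(* Here-and-there semantics with strong negation: [V false] is the world
   "here", [V true] the world "there"; [s = true] is verification and
   [s = false] falsification. *)
Fixpoint sat V (w s : bool) (F : formula A) : Prop :=
  match F with
  | Atom a => V w (if s then Pos a else Neg a)
  | Bot => if s then False else True
  | And F G => if s then sat V w s F /\ sat V w s G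
               else sat V w s F \/ sat V w s G
  | Or F G => if s then sat V w s F \/ sat V w s G
              else sat V w s F /\ sat V w s G
  | Imp F G => if s then (sat V w true F -> sat V w true G) /\
                         (sat V true true F -> sat V true true G)
               else sat V w true F /\ sat V w false G
  | SNeg F => sat V w (~~ s) F
  end.

Definition models M (F : formula A) : Prop := sat (fun=> M) true true F.

(** The world there sees only itself, so evaluation in it reduces to the total interpretation used
    by [models]. *)
Lemma sat_there V s F : sat V true s F <-> sat (fun=> V true) true s F.
Proof.
elim: F s => [a||F IF G IG|F IF G IG|F IF G IG|F IF] [] /=; try tauto;
  try (exact: IF); move: (IF true) (IF false) (IG true) (IG false); tauto.
Qed.

(** Verification and falsification are handled in one induction because [SNeg] exchanges them and a
    falsified implication involves both. *)
Lemma sat_persist V w s F : subset (V false) (V true) ->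
  sat V w s F -> sat V true s F.
Proof.
case: w => // sub.
elim: F s => [a||F IF G IG|F IF G IG|F IF G IG|F IF] [] /=; try tauto;
  try (exact: IF); try (exact: sub);
  move: (IF true) (IF false) (IG true) (IG false); tauto.
Qed.

Lemma N2_sound V T F : consistent_literals (V true) ->
  subset (V false) (V true) -> N2_derives T F ->
  (forall G, T G -> forall w, sat V w true G) -> forall w, sat V w true F.
Proof.
move=> cons sub + TV; elim=> {F} [F /TV //|F|F G _ FG _ IF w]; last first.
  by have /= [FGw _] := FG w; apply: FGw.
have pers w G := @sat_persist V w true G sub.
case=> {F} [F G|F G H|F G|F G|F G|F G|F G|F G H|F|F G|F G|F G|F|F|a|F G] w /=;
  try (move: (pers w F) => ?); try (move: (pers w G) => ?);
  try (move: (pers w H) => ?); try tauto.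
(* Axiom [ax_sneg_atom]: literals holding here also hold there, where an atom and its strong
   negation exclude each other. *)
- move: (sub (Pos a)) (sub (Neg a)) (cons (Pos a)) => /=.
  case: w; tauto.
(* Axiom [ax_HT]: if [G] fails there, persistence gives [Not G] at [w]; if [G] holds there and [F]
   fails at [w], then [Imp F G] holds at [w]. *)
- move: (EM (sat V w true F)) (EM (sat V true true G)) (EM (sat V true true F)).
  tauto.
Qed.

Lemma sat_lit V w (l : literal A) : sat V w true (lit_formula l) = V w l.
Proof. by case: l. Qed.

(* A theory such as the completion by [M], over which negations are classical *)
Definition decides M (T : set (formula A)) : Prop :=
  (forall l, ~ M l -> N2_derives T (Not (lit_formula l))) /\
  (forall l, M l -> N2_derives T (Not (Not (lit_formula l)))).

(** Both halves are proved together because [Not] exchanges them. The derivations are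
    intuitionistic; excluded middle serves only in the metatheory, to evaluate subformulas in
    [M]. *)
Lemma decides_program_body M T F : decides M T -> program_body F ->
  (models M F -> N2_derives T (Not (Not F))) /\
  (~ models M F -> N2_derives T (Not F)).
Proof.
rewrite /models => -[nlit lit].
have id_bot : N2_derives T (Not Bot) by apply: N2_deduction; apply: N2_assumption.
elim=> {F} [l|||F G _ [yF nF] _ [yG nG]|F G _ [yF nF] _ [yG nG]|F _ [yF nF]] /=.
- by rewrite sat_lit; split; [apply: lit|apply: nlit].
- by split=> [_|[]//]; apply: N2_notnotI.
- by split.
- split=> [[/yF ? /yG ?]|]; first exact: N2_notnot_and.
  have [MF nFG|/nF ? _] := EM (sat (fun=> M) true true F).
    by apply: N2_imp_trans (N2_andr _ _ _) (nG _) => MG; apply: nFG.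
  exact: N2_imp_trans (N2_andl _ _ _) _.
- split=> [[/yF|/yG] nn|nFG].
  + by apply: der_mp nn; do 2 apply: N2_contra; apply/der_axiom/ax_orl.
  + by apply: der_mp nn; do 2 apply: N2_contra; apply/der_axiom/ax_orr.
  + by apply: N2_not_or; [apply: nF|apply: nG] => ?; apply: nFG; tauto.
- split=> [[MF _]|nMF]; first by apply/N2_notnotI/nF.
  apply: yF; have [//|MF] := EM (sat (fun=> M) true true F).
  by case: nMF.
Qed.

End Semantics.

(** * Rule bodies and supports: their syntactic form and their truth in a set of literals *)

Section Programs.
Set Implicit Arguments.
Unset Strict Implicit.
Context {A : choiceType}.
Implicit Types (P Q : elp A) (M : set (literal A)) (L : literal A) (r : rule A).

Lemma program_body_xlit (B : xliteral A) : program_body (xlit_formula B).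
Proof. by case: B => [l||]; [apply: pb_lit|apply: pb_top|apply: pb_bot]. Qed.

Lemma program_body_conj (s : seq (formula A)) :
  (forall F, F \in s -> program_body F) -> program_body (conj_seq s).
Proof.
elim: s => [_|F [|G s] IH ps]; [exact: pb_top|by apply: ps; rewrite mem_head|].
apply: pb_and; first by apply: ps; rewrite mem_head.
by apply: IH => H Hs; apply: ps; rewrite inE Hs orbT.
Qed.

Lemma program_body_disj (s : seq (formula A)) :
  (forall F, F \in s -> program_body F) -> program_body (disj_seq s).
Proof.
elim: s => [_|F [|G s] IH ps]; [exact: pb_bot|by apply: ps; rewrite mem_head|].
apply: pb_or; first by apply: ps; rewrite mem_head.
by apply: IH => H Hs; apply: ps; rewrite inE Hs orbT.
Qed.

Lemma program_body_body r : program_body (body r).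
Proof.
apply: program_body_conj => F; rewrite mem_cat => /orP[] /mapP[B _ ->].
  exact: program_body_xlit.
exact/pb_not/program_body_xlit.
Qed.

Lemma program_body_sup L P : program_body (sup L P).
Proof.
rewrite /sup; case: ifP => _; first exact: pb_bot.
case: ifP => _; first exact: pb_top.
by apply: program_body_disj => F /imfsetP[r _ ->]; apply: program_body_body.
Qed.

Lemma program_body_sup_complement (B : xliteral A) P :
  program_body (sup_complement B P).
Proof.
by case: B => [l||]; [apply: program_body_sup|apply: pb_bot|apply: pb_bot].
Qed.

Lemma sat_conj V w (s : seq (formula A)) :
  sat V w true (conj_seq s) <-> forall F, F \in s -> sat V w true F.
Proof.
elim: s => [|F [|G s] IH]; first by split=> //= _; split.
- by split=> [? H|]; [rewrite inE => /eqP->|apply; rewrite mem_head].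
- split=> [[? /IH gs] H|all_s].
    by rewrite inE => /orP[/eqP->//|]; apply: gs.
  split; first by apply: all_s; rewrite mem_head.
  by apply/IH => H Hs; apply: all_s; rewrite inE Hs orbT.
Qed.

Lemma models_disj M (s : seq (formula A)) :
  models M (disj_seq s) <-> exists2 F, F \in s & models M F.
Proof.
elim: s => [|F [|G s] IH]; first by split=> // -[].
- by split=> [?|[H]]; [exists F; rewrite ?mem_head|rewrite inE => /eqP->].
- split=> [[?|/IH[H Hs ?]]|[H]].
  + by exists F; rewrite ?mem_head.
  + by exists H; rewrite // inE Hs orbT.
  + by rewrite inE => /orP[/eqP->|Hs MH]; [left|right; apply/IH; exists H].
Qed.

(** In all three cases [sup L P] has the value of the disjunction over [bodies L P]: an empty
    disjunction is false, and one with disjunct [Top] is true. *)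
Lemma models_sup M L P : models M (sup L P) <->
  exists r, [/\ r \in P, rule_head r = XLit L & models M (body r)].
Proof.
have -> : models M (sup L P) <-> exists2 F, F \in bodies L P & models M F.
  rewrite /sup; case: eqP => [->|_]; first by split=> // -[F]; rewrite inE.
  case: ifP => [topP|_]; last exact: models_disj.
  by split=> [MT|_]; [exists Top|split].
split=> [[F /imfsetP[r]]|[r [rP hr Mr]]].
  by rewrite !inE /= => /andP[rP /eqP hr] -> ?; exists r.
by exists (body r) => //; apply/imfsetP; exists r; rewrite // !inE rP /= hr eqxx.
Qed.

Lemma elp_formulasP F P :
  reflect (exists2 r, r \in P & F = rule_formula r) (F \in elp_formulas P).
Proof. exact: imfsetP. Qed.

(** * The formulas of an update, and (BK-1) to (BK-3) *)

Variant update3_spec P1 P2 (F : formula A) : Prop :=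
| Update3Constraint r of r \in P1 & is_constraint r & F = rule_formula r
| Update3Weakened r of r \in P1 & ~~ is_constraint r & F = weakened_rule P2 r
| Update3Rule r of r \in P2 & F = rule_formula r.

Lemma update3P P1 P2 F : F \in update3 P1 P2 <-> update3_spec P1 P2 F.
Proof.
rewrite /update3 !in_fsetU; split.
  case/orP=> [/orP[]|] /imfsetP[r]; rewrite ?inE /=.
  - case/andP=> /orP[] rP cr ->; first exact: Update3Constraint rP cr _.
    exact: Update3Rule rP _.
  - by case/andP=> rP ncr ->; apply: Update3Weakened rP ncr _.
  - by move=> rP ->; apply: Update3Rule rP _.
case=> r rP => [cr ->|ncr ->|->]; apply/orP.
- by left; apply/orP; left; apply/imfsetP; exists r; rewrite // !inE rP cr.
- by left; apply/orP; right; apply/imfsetP; exists r; rewrite // !inE rP ncr.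
- by right; apply/imfsetP; exists r.
Qed.

Lemma is_program_update3 P1 P2 : is_program (update3 P1 P2).
Proof.
move=> F /update3P[r _ _ ->|r _ _ ->|r _ ->]; do 2 eexists; split; try by [];
  last exact: program_body_body; first exact: program_body_body.
apply: pb_and (program_body_body r) _.
exact/pb_not/program_body_sup_complement.
Qed.

Lemma update3_derives_right P1 P2 :
  N2_derives_all (theory (update3 P1 P2)) (theory (elp_formulas P2)).
Proof.
move=> F /elp_formulasP[r rP ->]; apply/der_hyp/update3P.
exact: Update3Rule rP _.
Qed.

(** Weakening a rule adds a conjunct to its body, so the original rule derives the weakened one. *)
Lemma union_derives_update3 P1 P2 :
  N2_derives_all (theory (elp_formulas (P1 `|` P2))) (theory (update3 P1 P2)).
Proof.
have hyp r : r \in P1 `|` P2 ->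
    N2_derives (theory (elp_formulas (P1 `|` P2))) (rule_formula r).
  by move=> rP; apply/der_hyp/elp_formulasP; exists r.
move=> F /update3P[r rP _ ->|r rP _ ->|r rP ->].
- by apply: hyp; rewrite inE rP.
- by apply: N2_imp_trans (N2_andl _ _ _) (hyp _ _); rewrite inE rP.
- by apply: hyp; rewrite inE rP orbT.
Qed.

(** * Supports in equivalent programs, and transfer of answer sets for (BK-6) *)

Lemma models_sup_equiv P Q M L : consistent_literals M -> tau_free P ->
  N2_derives_all (theory (elp_formulas Q)) (theory (elp_formulas P)) ->
  (forall r, r \in Q -> models M (rule_formula r)) ->
  models M (sup L P) -> models M (sup L Q).
Proof.
move=> cons tauP QP MQ /models_sup[r [rP hr Mr]]; apply: contrapT => nsup.
(* The disjunct [w] lifts the exclusion of [L] in the world there, so that only the world here loses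
   [L]. *)
pose V (w : bool) : set (literal A) := fun l => M l /\ (w \/ l <> L).
have VM : V true = M.
  by apply/funext => l; apply/propext; split=> [[]|Ml] //; split=> //; left.
have sub : subset (V false) (V true) by move=> l [Ml _]; split=> //; left.
have there F : sat V true true F <-> models M F by rewrite sat_there VM.
have {}consV : consistent_literals (V true) by rewrite VM.
(* A rule of [Q] true in [M] could fail here only by having head [L] and a body true in [M], which
   [nsup] rules out. *)
have VQ G : theory (elp_formulas Q) G -> forall w, sat V w true G.
  case/elp_formulasP=> r' r'Q -> w.
  have Mr' : models M (body r') -> models M (xlit_formula (rule_head r')).
    by have [] := MQ r' r'Q.
  split; last by move=> /there/Mr'/there.
  move=> br'; have {}br' : models M (body r').
    by apply/there; apply: sat_persist br'.
  have := Mr' br'; case E : (rule_head r') => [l||] //.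
  rewrite /models !sat_lit => Ml; split=> //.
  have [lL|lL] := EM (l = L); last by right.
  by case: nsup; apply/models_sup; exists r'; rewrite E lL.
have rr : N2_derives (theory (elp_formulas Q)) (rule_formula r).
  by apply: QP; apply/elp_formulasP; exists r.
have /= [+ _] := N2_sound consV sub rr VQ false.
(* The head [L] is absent here, so verifying the body of [r] here gives the contradiction. *)
rewrite hr /= sat_lit => -[|_ []//].
move/sat_conj: Mr => Mr; apply/sat_conj => F Fr.
have {Mr} MF := Mr F Fr; move: Fr; rewrite mem_cat => /orP[] /mapP[B Br EF].
  (* A positive literal of the body holds in [M] and differs from [L] by tau-freeness, so it
     survives here. *)
  case: B => [l||] in Br EF *; rewrite EF //= in MF *.
  rewrite !sat_lit in MF *; split=> //; right=> lL.
  by have := tauP r L rP hr; rewrite -lL Br.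
rewrite EF /= in MF *; case: MF => nMB _.
(* A negated element fails there, hence also here by persistence. *)
have nB : ~ sat V true true (xlit_formula B) by rewrite there.
by split=> // /(sat_persist sub).
Qed.

Lemma completion_decides (T : {fset formula A}) M : decides M (completion T M).
Proof.
split=> l Ml; apply: der_hyp; [left; right|right]; by exists l.
Qed.

(** Were the body true and the head false in [M], the completion would derive the double negation of
    the body and the negation of the head, hence with the rule [Bot]. *)
Lemma completion_models T M r : ~ N2_inconsistent (completion T M) ->
  N2_derives (completion T M) (rule_formula r) -> models M (rule_formula r).
Proof.
move=> cons Tr; have dec := completion_decides T M.
suff sub : models M (body r) -> models M (xlit_formula (rule_head r)) by split.
move=> Mb; apply: contrapT => nMh; apply: cons.
have [/(_ Mb) nnb _] := decides_program_body dec (program_body_body r).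
have [_ /(_ nMh) nh] :=
  decides_program_body dec (program_body_xlit (rule_head r)).
by apply: der_mp nnb _; apply: N2_imp_trans Tr nh.
Qed.

Lemma completion_update3_derives P P1 P2 M :
  consistent_literals M -> tau_free P1 ->
  N2_equiv (theory (elp_formulas P1)) (theory (elp_formulas P2)) ->
  (forall r, r \in P2 -> models M (rule_formula r)) ->
  N2_derives_all (completion (update3 P P1) M) (completion (update3 P P2) M).
Proof.
move=> cons tau1 [P12 P21] M2.
set C := completion (update3 P P1) M.
have dec : decides M C by apply: completion_decides.
have hyp F : F \in update3 P P1 -> N2_derives C F.
  by move=> ?; apply: der_hyp; left; left.
have C1 : N2_derives_all C (theory (elp_formulas P1)).
  by move=> F /(update3_derives_right P); apply: N2_cut.
move=> F [[|[l Ml <-]]|[l Ml <-]]; [|exact: dec.1|exact: dec.2].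
case/update3P=> r rP => [cr ->|ncr ->|->].
- by apply/hyp/update3P; apply: Update3Constraint rP cr _.
- have Cr : N2_derives C (weakened_rule P1 r).
    by apply/hyp/update3P; apply: Update3Weakened rP ncr _.
  apply: N2_imp_trans Cr; apply: N2_and_mono.
  (* It remains to derive [Not] of the support in [P1] from [Not] of the support in [P2], which
     calls for this direction between the supports. *)
  have sup12 : models M (sup_complement (rule_head r) P1) ->
               models M (sup_complement (rule_head r) P2).
    by case: (rule_head r) => [l||] //; apply: models_sup_equiv.
  have [/sup12 M2s|nM1s] := EM (models M (sup_complement (rule_head r) P1)).
    (* The support in [P2] is doubly negated in [C], so its negation leads to [Bot] and thence to
       anything. *)
    have [/(_ M2s) nn _] := decides_program_body dec
      (program_body_sup_complement (rule_head r) P2).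
    by apply: N2_imp_trans nn _; apply/der_axiom/ax_bot.
  have [_ /(_ nM1s)] := decides_program_body dec
    (program_body_sup_complement (rule_head r) P1).
  exact: N2_imp_const.
- by apply: N2_cut C1 _; apply: P12; apply/elp_formulasP; exists r.
Qed.

(** Consistency of the completion makes [M] a model of [P1], hence of [P2], so the two completions
    derive each other. One direction transfers consistency, the other the derivations of the
    literals in [M]. *)
Lemma answer_set_update3_sub P P1 P2 M : tau_free P1 -> tau_free P2 ->
  N2_equiv (theory (elp_formulas P1)) (theory (elp_formulas P2)) ->
  answer_set (update3 P P1) M -> answer_set (update3 P P2) M.
Proof.
move=> tau1 tau2 eq12 [cons Ccons CM]; have [P12 P21] := eq12.
have C1 : N2_derives_all (completion (update3 P P1) M)
                         (theory (elp_formulas P1)).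
  move=> F /(update3_derives_right P); apply: N2_mono => G ?; by left; left.
have M1 r : r \in P1 -> models M (rule_formula r).
  move=> rP; apply: completion_models Ccons _; apply: C1.
  by apply/elp_formulasP; exists r.
have M2 r : r \in P2 -> models M (rule_formula r).
  move=> rP; apply: completion_models Ccons _; apply: N2_cut C1 _; apply: P12.
  by apply/elp_formulasP; exists r.
have C12 := completion_update3_derives (P := P) cons tau1 eq12 M2.
have C21 := completion_update3_derives (P := P) cons tau2 (conj P21 P12) M1.
split=> // [C2bot|l Ml]; first by apply: Ccons; apply: N2_cut C12 C2bot.
by apply: N2_cut C21 (CM l Ml).
Qed.

End Programs.

Theorem theorem5p6 (A : choiceType) :
  [/\ (* BK-1 *)
      forall (P : elp A) (x : rule A), is_program (update3 P [fset x]),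
      (* BK-2 *)
      forall P1 P2 : elp A,
        N2_derives_all (theory (update3 P1 P2)) (theory (elp_formulas P2)),
      (* BK-3 *)
      forall P1 P2 : elp A,
        N2_derives_all (theory (elp_formulas (P1 `|` P2)))
                       (theory (update3 P1 P2)),
      (* BK-5 *)
      forall P1 P2 : elp A,
        N2_inconsistent (theory (elp_formulas P2)) ->
        N2_inconsistent (theory (update3 P1 P2)) &
      (* BK-6 *)
      forall P P1 P2 : elp A,
        tau_free P1 -> tau_free P2 ->
        N2_equiv (theory (elp_formulas P1)) (theory (elp_formulas P2)) ->
        forall M : set (literal A),
          answer_set (update3 P P1) M <-> answer_set (update3 P P2) M].
Proof.
split.
- by move=> P x; apply: is_program_update3.
- exact: update3_derives_right.
- exact: union_derives_update3.
(* (BK-5) follows from (BK-2): a derivation of [Bot] from [P2] is replayed from the update. *)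
- by move=> P1 P2; apply/N2_cut/update3_derives_right.
- move=> P P1 P2 tau1 tau2 eq12 M; split; apply: answer_set_update3_sub => //.
  by case: eq12.
Qed.
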